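(* Let $\Delta$ be a simplicial complex, and let $\mathrm{br}(\Delta)$ denote its barycentric subdivision. Then there is a (finite) sequence of edge subdivisions from $\Delta$ to $\mathrm{br}(\Delta)$.
   Context: A simplicial complex on a finite vertex set $V$ is a finite system $\Delta\subseteq 2^V$ closed under taking subsets; its elements are faces. The barycentric subdivision $\mathrm{br}(\Delta)$ is the simplicial complex whose vertices are indexed by the nonempty faces of $\Delta$ and whose simplices are the sets of faces forming a chain with respect to inclusion. For a nonempty face $F\in\Delta$, the stellar subdivision of $\Delta$ at $F$ is $$\mathrm{stellar}_\Delta(F)=\{F'\in\Delta: F\not\subseteq F'\}\cup\big(\{v_F\}*\partial F*\mathrm{lk}_\Delta(F)\big),$$ where $v_F$ is a new vertex, $\{v_F\}$ in the join denotes the complex $\{\emptyset,\{v_F\}\}$, $\partial F=\{F':F'\subsetneq F\}$, $\mathrm{lk}_\Delta(F)=\{F'\in\Delta:F\cap F'=\emptyset,F\cup F'\in\Delta\}$, and $*$ is the join $\Delta*\Delta'=\{G\cup G':G\in\Delta,G'\in\Delta'\}$ of complexes on disjoint vertex sets. An edge subdivision is a stellar subdivision at a face $F$ with $|F|=2$. Each subdivision in the sequence is applied to the complex produced by the preceding ones (no inverse subdivisions are used). Complexes are considered up to combinatorial isomorphism (relabeling of vertices). *)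

(* Defs.v *)
From mathcomp Require Import all_boot.

Set Implicit Arguments.
Unset Strict Implicit.
Unset Printing Implicit Defensive.

(* The elements of V need not all be vertices of D, and the void complex set0
   (without even the empty face) is allowed. *)
Definition simplicial_complex (V : finType) (D : {set {set V}}) : Prop :=
  forall F G : {set V}, F \in D -> G \subset F -> G \in D.

(* The join of complexes on disjoint vertex sets, rendered as complexes on a
   common ambient type; disjointness is not enforced, but it holds below. *)
Definition cjoin (V : finType) (A B : {set {set V}}) : {set {set V}} :=
  [set G :|: H | G in A, H in B].

Definition boundary (V : finType) (F : {set V}) : {set {set V}} :=
  [set G : {set V} | G \proper F].

Definition link (V : finType) (D : {set {set V}}) (F : {set V}) :
    {set {set V}} :=
  [set G in D | [disjoint F & G] & F :|: G \in D].

Definition add_vertex (V : finType) (D : {set {set V}}) :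
    {set {set option V}} :=
  [set [set Some x | x in G] | G : {set V} in D].

(* The old vertices are the Some x, and None is the new vertex v_F. *)
Definition stellar (V : finType) (D : {set {set V}}) (F : {set V}) :
    {set {set option V}} :=
  add_vertex [set G in D | ~~ (F \subset G)] :|:
  cjoin [set set0; [set None]] (add_vertex (cjoin (boundary F) (link D F))).

Inductive edge_subdivisions (V : finType) (D : {set {set V}}) :
    forall W : finType, {set {set W}} -> Prop :=
| EdgeSubdivisionsNil : edge_subdivisions D D
| EdgeSubdivisionsRcons (W : finType) (E : {set {set W}}) (e : {set W}) :
    edge_subdivisions D E -> e \in E -> #|e| = 2 ->
    edge_subdivisions D (stellar E e).

Definition is_chain (V : finType) (C : {set {set V}}) : bool :=
  [forall F in C, forall G in C, (F \subset G) || (G \subset F)].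

(* The guard D != set0 only matters for the void complex: without it, the empty
   chain would be a face of the subdivision of a complex with no face. *)
Definition barycentric (V : finType) (D : {set {set V}}) :
    {set {set {set V}}} :=
  [set C : {set {set V}} | [&& D != set0, C \subset D :\ set0 & is_chain C]].

Definition vertex (V : finType) (D : {set {set V}}) : finType :=
  {x : V | [set x] \in D}.

(* A relabeling is a bijection between the actual vertices, not between the
   ambient types, which may contain unused elements. *)
Definition complex_iso (V W : finType) (D : {set {set V}})
    (E : {set {set W}}) : Prop :=
  exists2 f : vertex D -> vertex E, bijective f &
    forall F : {set vertex D},
      ([set val x | x in F] \in D) = ([set val (f x) | x in F] \in E).

(* Main.v *)
Require Import Defs.
From mathcomp Require Import all_boot.

Set Implicit Arguments.
Unset Strict Implicit.
Unset Printing Implicit Defensive.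

(** The passage from a complex D to its barycentric subdivision goes through
    complexes of nested sets. Let B be a family of nonempty sets of vertices
    containing all singletons and, besides them, only faces of D. The faces of
    the nested complex of B are the subfamilies C of B whose union is a face
    of D and such that a union of members of C that belongs to B already is
    one of these members. If B consists of the singletons, this is D itself
    ([nested_singletons]); if B contains all nonempty faces, a nested set is a
    chain of faces, and the nested complex is the barycentric subdivision
    ([nested_full]).

    Suppose that F = x |: S, with x not in S, is a face of D outside B, that S
    and [set x] belong to B, that every member of B contained in F is
    contained in S or equals [set x], and that U :|: F belongs to F |: B for
    every U in B that meets F and has a union with F in D. Then the nested
    complex of F |: B is the stellar subdivision of the nested complex of B at
    the edge {S, [set x]}, with F as the new vertex ([nested_add_old],
    [nested_add_new]).

    It remains to add the faces with at least two elements one at a time so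
    that these conditions hold at each step. Fix a linear order on V, and add
    the faces by increasing maximal element and, for a given maximal element,
    by decreasing cardinality; take for x the maximum of F. Then S is a
    singleton or has a smaller maximum, so it is already present; a present
    set that contains x, is contained in F, and differs from [set x] would be
    smaller than F with the same maximum, hence would come later than F; and
    if U is present, a face U :|: F larger than F has the same maximum as F
    and more elements, hence came earlier ([stage_realized]). *)

(** * Faces of a stellar subdivision *)

Section Stellar.
Variables (W : finType) (E : {set {set W}}).
Hypothesis hE : simplicial_complex E.

(** The set of old vertices in a set of vertices of a subdivision. *)
Definition old_part (G : {set option W}) : {set W} := Some @^-1: G.

Lemma old_part_imset (H : {set W}) : old_part (Some @: H) = H.
Proof.
by apply/setP => w; rewrite inE mem_imset // => ? ? [].
Qed.

Lemma old_partK (G : {set option W}) :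
  G = (if None \in G then [set None] else set0) :|: Some @: old_part G.
Proof.
have SomeI : injective (@Some W) by move=> ? ? [].
apply/setP => -[w|]; rewrite inE.
  by rewrite (mem_imset _ _ SomeI) inE; case: ifP; rewrite inE.
have -> : (None \in Some @: old_part G) = false.
  by apply/negbTE/imsetP => -[].
by rewrite orbF; case: ifP; rewrite inE ?eqxx.
Qed.

Lemma mem_add_vertex (D : {set {set W}}) (G : {set option W}) :
  (G \in add_vertex D) = (None \notin G) && (old_part G \in D).
Proof.
apply/imsetP/andP => [[H HD ->]|[nG GD]].
  split; first by apply/imsetP => -[].
  by rewrite -[[set _ | _ in _]]/(Some @: H) old_part_imset.
by exists (old_part G); rewrite // {1}(old_partK G) (negbTE nG) set0U.
Qed.

(** A join of a proper subset of [e] with a face of the link of [e] is a set [H]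
    that does not contain [e] and whose union with [e] is a face: the two
    factors are recovered as [H :&: e] and [H :\: e]. *)
Lemma mem_cjoin_boundary_link (e H : {set W}) :
  (H \in cjoin (boundary e) (link E e)) =
  (e :|: H \in E) && ~~ (e \subset H).
Proof.
apply/imset2P/andP => [[A B]|[eHE eH]].
  rewrite !inE => Ae /and3P[BE eB eBE] ->; split.
    by rewrite setUA (setUidPl (proper_sub Ae)).
  apply/subsetP => sub; case/properP: Ae => _ [w we /negP wA].
  case/setUP: (sub w we) => // wB.
  by move: (disjointFr eB we); rewrite wB.
exists (H :&: e) (H :\: e); last by rewrite setID.
- rewrite inE properE subsetIr /=.
  by apply: contra eH => /subset_trans; apply; apply: subsetIl.
- rewrite inE; apply/and3P; split.
  + by apply: (hE eHE); apply: subset_trans (subsetDl _ _) (subsetUr _ _).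
  + by rewrite -setI_eq0 setIDA setIC setDE -setIA setICr setI0 eqxx.
  + suff -> : e :|: H :\: e = e :|: H by [].
    by apply/setP => w; rewrite !inE; case: (w \in e).
Qed.

(** The stellar subdivision described face by face. *)
Lemma mem_stellar (e : {set W}) (G : {set option W}) :
  (G \in stellar E e) =
  ((if None \in G then e :|: old_part G \in E else old_part G \in E)
     && ~~ (e \subset old_part G)).
Proof.
rewrite inE mem_add_vertex inE.
have -> : (G \in cjoin [set set0; [set None]]
                   (add_vertex (cjoin (boundary e) (link E e)))) =
          (old_part G \in cjoin (boundary e) (link E e)).
  apply/imset2P/idP => [[A B]|GJ].
    rewrite !inE mem_add_vertex => AP /andP[_ BJ] ->.
    suff -> : old_part (A :|: B) = old_part B by [].
    by apply/setP => w; rewrite !inE; case/orP: AP => /eqP->; rewrite inE.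
  exists (if None \in G then [set None] else set0) (Some @: old_part G).
  - by case: ifP; rewrite !inE eqxx ?orbT.
  - rewrite mem_add_vertex old_part_imset GJ andbT.
    by apply/imsetP => -[].
  - exact: old_partK.
rewrite mem_cjoin_boundary_link; case: ifP => //= _.
rewrite -andb_orl; case: (boolP (old_part G \in E)) => //= nG.
by case: (boolP (_ :|: _ \in E)) => // /hE /(_ (subsetUr _ _)); rewrite (negbTE nG).
Qed.

End Stellar.

(** * Nested complexes *)

Section Nested.
Variables (V : finType) (D : {set {set V}}).
Hypothesis hD : simplicial_complex D.
Implicit Types (B C M : {set {set V}}) (F S T U : {set V}).

(** The nested complex of [B]. A more usual definition asks that no union of at
    least two pairwise incomparable members of [C] belong to [B]; when [B] does
    not contain the empty set, the condition below on all subfamilies [M] is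
    equivalent to it, because the maximal members of [M] are pairwise
    incomparable and have the same union as [M]. *)
Definition nested B : {set {set {set V}}} :=
  [set C : {set {set V}} | [&& C \subset B, cover C \in D &
    [forall (M : {set {set V}} | M \subset C),
       (cover M \in B) ==> (cover M \in M)]]].

Lemma nestedP B C :
  reflect [/\ C \subset B, cover C \in D &
             forall M, M \subset C -> cover M \in B -> cover M \in M]
          (C \in nested B).
Proof.
rewrite inE; apply: (iffP and3P) => -[CB CD CM]; split=> //.
  by move=> M MC MB; move/forall_inP/(_ M MC)/implyP: CM; apply.
by apply/forall_inP => M MC; apply/implyP; apply: CM.
Qed.

Lemma coverS M C : M \subset C -> cover M \subset cover C.
Proof.
by move=> MC; apply/bigcupsP => T TM; apply: bigcup_sup; apply: (subsetP MC).
Qed.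

Lemma coverU M C : cover (M :|: C) = cover M :|: cover C.
Proof. exact: bigcup_setU. Qed.

Lemma coverU1 T C : cover (T |: C) = T :|: cover C.
Proof. by rewrite coverU /cover big_set1. Qed.

Lemma sub_cover T C : T \in C -> T \subset cover C.
Proof. by move=> TC; apply: bigcup_sup. Qed.

Lemma nested_complex B : simplicial_complex (nested B).
Proof.
move=> C C' /nestedP[CB CD CM] C'C; apply/nestedP; split.
- exact: subset_trans CB.
- exact: hD CD (coverS C'C).
- by move=> M MC'; apply: CM; apply: subset_trans C'C.
Qed.

(** * Adding a face to the family is an edge subdivision *)

Section Step.
Variables (B : {set {set V}}) (S : {set V}) (x : V).
Let F := x |: S.
Let e := [set S; [set x]].
Hypotheses (B0 : set0 \notin B) (FB : F \notin B) (FD : F \in D).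
Hypotheses (SB : S \in B) (xB : [set x] \in B) (xS : x \notin S).
Hypothesis factors :
  forall T, T \in B -> T \subset F -> T \subset S \/ T = [set x].
Hypothesis building :
  forall U, U \in B -> ~~ [disjoint U & F] -> U :|: F \in D ->
    U :|: F \in F |: B.

Let cover_e : cover e = F.
Proof. by rewrite coverU1 /cover big_set1 setUC. Qed.

Let eB : e \subset B.
Proof. by apply/subsetP => T /set2P[]->. Qed.

Lemma edge_nested : e \in nested B.
Proof.
apply/nestedP; rewrite cover_e; split=> // M Me MB.
have [SM|SM] := boolP (S \in M); have [xM|xM] := boolP ([set x] \in M).
- suff eM : e \subset M.
    have := coverS eM; have := coverS Me; rewrite cover_e => h1 h2.
    have /eqP E : cover M == F by rewrite eqEsubset h1.
    by move: MB; rewrite E (negbTE FB).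
  by apply/subsetP => T /set2P[]->.
- have -> // : cover M = S.
  apply/eqP; rewrite eqEsubset sub_cover // andbT; apply/bigcupsP => T TM.
  by move: (TM); case/set2P: (subsetP Me T TM) => -> //; rewrite (negbTE xM).
- have -> // : cover M = [set x].
  apply/eqP; rewrite eqEsubset sub_cover // andbT; apply/bigcupsP => T TM.
  by move: (TM); case/set2P: (subsetP Me T TM) => -> //; rewrite (negbTE SM).
- have M0 : M = set0.
    apply/setP => T; rewrite inE; apply/negP => TM.
    by move: (TM); case/set2P: (subsetP Me T TM) => ->; rewrite ?(negbTE SM) ?(negbTE xM).
  by move: MB; rewrite M0 /cover big_set0 (negbTE B0).
Qed.

(** The members of [M] are contained in [S], except for [[set x]], which has to
    occur. The other ones have union [S], so that [S] is among them because [C]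
    is nested. *)
Lemma cover_factors C M :
  C \in nested B -> M \subset C -> cover M = F -> e \subset M.
Proof.
move=> /nestedP[CB CD CM] MC MF.
have xM : [set x] \in M.
  have : x \in cover M by rewrite MF !inE eqxx.
  case/bigcupP => T TM xT; have TF : T \subset F by rewrite -MF sub_cover.
  case: (factors (subsetP CB _ (subsetP MC _ TM)) TF) => [TS|<- //].
  by case/negP: (xS); apply: (subsetP TS).
suff SM : S \in M by apply/subsetP => T /set2P[]->.
have MxS : cover (M :\ [set x]) = S.
  apply/eqP; rewrite eqEsubset; apply/andP; split.
    apply/bigcupsP => T /setD1P[Tx TM].
    have TF : T \subset F by rewrite -MF sub_cover.
    case: (factors (subsetP CB _ (subsetP MC _ TM)) TF) => // TE.
    by rewrite TE eqxx in Tx.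
  apply/subsetP => y yS; have : y \in cover M by rewrite MF !inE yS orbT.
  case/bigcupP => T TM yT; apply/bigcupP; exists T => //.
  rewrite !inE TM andbT; apply: contraNneq xS => TE.
  by move: yT; rewrite TE inE => /eqP <-.
have := CM (M :\ [set x]) (subset_trans (subsetDl _ _) MC).
by rewrite MxS => /(_ SB) /setD1P[].
Qed.

(** The faces without the new vertex. *)
Lemma nested_add_old C : F \notin C ->
  (C \in nested (F |: B)) = (C \in nested B) && ~~ (e \subset C).
Proof.
move=> FC; apply/nestedP/andP => [[CB CD CM]|[CN eC]].
  split.
    apply/nestedP; split=> // [|M MC MB].
      apply/subsetP => T TC; case/setU1P: (subsetP CB _ TC) => // TF.
      by rewrite -TF TC in FC.
    by apply: CM => //; rewrite inE MB orbT.
  apply/negP => /CM; rewrite cover_e setU11 => /(_ isT).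
  by move=> FE; case/negP: (FB); case/set2P: FE => ->.
have /nestedP[CB CD CM] := CN.
split=> // [|M MC]; first exact: subset_trans CB (subsetUr _ _).
case/setU1P => [MF|]; last exact: CM.
by case/negP: eC; apply: subset_trans (cover_factors CN MC MF) MC.
Qed.

(** The faces with the new vertex. In both directions, a subfamily is turned
    into another one with the same union, up to [F], by exchanging [F] and its
    two factors. *)
Lemma nested_add_new (H : {set {set V}}) : F \notin H ->
  (F |: H \in nested (F |: B)) = (e :|: H \in nested B) && ~~ (e \subset H).
Proof.
move=> FH.
have cov : cover (F |: H) = cover (e :|: H) by rewrite coverU1 coverU cover_e.
apply/idP/andP => [CN|[CN eH]].
  have HN : H \in nested (F |: B).
    by apply: nested_complex CN _; apply: subsetUr.
  move: (HN); rewrite nested_add_old // => /andP[HNB eH]; split=> //.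
  have /nestedP[HB _ HM] := HNB; have /nestedP[CB CD CM] := CN.
  apply/nestedP; rewrite -cov; split=> //; first by rewrite subUset eB.
  move=> M MC MB; set U := cover M in MB *.
  have [eM|eM] := boolP [disjoint M & e].
    apply: (HM M) => //; apply/subsetP => T TM.
    case/setUP: (subsetP MC _ TM) => // Te.
    by move: (disjointFr eM TM); rewrite Te.
  have [T TM Te] : exists2 T, T \in M & T \in e.
    by case/pred0Pn: eM => T /andP[]; exists T.
  have TF : T \subset F by rewrite -cover_e sub_cover.
  have TU : T \subset U by rewrite sub_cover.
  have MDH : M :\: e \subset H.
    apply/subsetP => T' /setDP[T'M T'e].
    by case/setUP: (subsetP MC _ T'M) => // T'e'; rewrite T'e' in T'e.
  have covM : cover (F |: M :\: e) = U :|: F.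
    rewrite coverU1 [RHS]setUC -cover_e -!coverU; congr cover.
    by apply/setP => w; rewrite [LHS]in_setU [RHS]in_setU in_setD; case: (w \in e).
  (* The family [F |: M :\: e] is contained in the nested set [F |: H], so its
     union, as soon as it belongs to [F |: B], is one of its members. *)
  have UFB : U :|: F \in F |: B.
    apply: building => //.
      have [y yT] : exists y, y \in T.
        apply/set0Pn; apply: contraNneq B0 => <-; exact: (subsetP eB).
      apply/pred0Pn; exists y.
      by rewrite /= (subsetP TU _ yT) (subsetP TF _ yT).
    apply: hD CD _; rewrite cov -covM coverU1 coverU cover_e.
    by apply: setUS; apply: coverS.
  have := CM (F |: M :\: e); rewrite covM setUS // => /(_ isT UFB).
  case/setU1P => [UF|/setDP[UFM _]]; last first.
    suff -> : U = U :|: F by [].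
    apply/eqP; rewrite eqEsubset subsetUl; exact: sub_cover.
  have US : U \subset F by rewrite -UF subsetUl.
  case: (factors MB US) => [{}US|Ux].
    have TS : T = S.
      case/set2P: Te => // Tx; move: (subset_trans TU US).
      by rewrite Tx sub1set (negbTE xS).
    suff -> : U = S by rewrite -TS.
    by apply/eqP; rewrite eqEsubset US -TS.
  suff -> : U = T by [].
  have T0 : T != set0.
    by apply: contraNneq B0 => <-; apply: (subsetP eB).
  apply/eqP; rewrite eqEsubset TU andbT Ux.
  by move: TU; rewrite Ux subset1 (negbTE T0) orbF => /eqP->.
have /nestedP[CB CD CM] := CN.
have eHB : H \subset B by apply: subset_trans CB; apply: subsetUr.
apply/nestedP; rewrite cov; split=> //; first exact: setUS.
move=> M MC UB; have [FM|FM] := boolP (F \in M); last first.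
  have MH : M \subset H.
    apply/subsetP => T TM; case/setU1P: (subsetP MC _ TM) => // TF.
    by rewrite -TF TM in FM.
  have MeH : M \subset e :|: H := subset_trans MH (subsetUr _ _).
  case/setU1P: UB => [UF|]; last exact: CM.
  by case/negP: eH; apply: subset_trans (cover_factors CN MeH UF) MH.
have FU : F \subset cover M by apply: sub_cover.
case/setU1P: UB => [-> //|UB].
have MFH : M :\ F \subset H.
  apply/subsetP => T /setD1P[TF TM].
  by case/setU1P: (subsetP MC _ TM) => // TE; rewrite TE eqxx in TF.
have covM : cover (e :|: M :\ F) = cover M.
  by rewrite coverU cover_e -coverU1 setD1K.
have := CM (e :|: M :\ F); rewrite covM setUS // => /(_ isT UB).
case/setUP => [|/setD1P[] //] /set2P[] UE; move: FU; rewrite UE => sub.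
  by move: (subsetP sub x (setU11 _ _)); rewrite (negbTE xS).
case/negP: (FB); suff -> : F = [set x] by [].
by apply/eqP; rewrite eqEsubset sub sub1set setU11.
Qed.

End Step.

(** * The first and the last nested complexes *)

Definition singletons : {set {set V}} := [set [set x] | x : V].

Lemma cover_set1 (G : {set V}) : cover (set1 @: G) = G.
Proof.
apply/setP => y; apply/bigcupP/idP => [[_ /imsetP[z zG ->]]|yG].
  by rewrite inE => /eqP->.
by exists [set y]; rewrite ?inE // imset_f.
Qed.

(** The family of all singletons gives back [D]. *)
Lemma nested_singletons (G : {set V}) :
  (G \in D) = (set1 @: G \in nested singletons).
Proof.
apply/idP/nestedP => [GD|[_]]; rewrite cover_set1 //.
split=> // [|M MG].
  by apply/subsetP => _ /imsetP[y _ ->]; rewrite imset_f.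
case/imsetP => y _ MyE; rewrite MyE.
have : y \in cover M by rewrite MyE inE.
case/bigcupP => T TM; case/imsetP: (subsetP MG _ TM) => z _ TE.
by move: TM; rewrite TE inE => zM /eqP->.
Qed.

(** The singletons that are not faces are kept: they are no vertices of the
    nested complex, and each point of an ambient type of vertices can then be
    matched with a member of the family. *)
Definition full : {set {set V}} := singletons :|: D :\ set0.

(** In the nested complex of all nonempty faces, two members of a face have
    their union in the family, so one of them contains the other.
    Conversely, a union of members of a nonempty chain is its largest member. *)
Lemma nested_full : nested full = barycentric D.
Proof.
apply/setP => C; rewrite [RHS]inE; apply/nestedP/and3P => [[CF CD CM]|[D0 CD ch]].
  split.
  - by apply/set0Pn; exists (cover C).
  - apply/subsetP => T TC; rewrite !inE (hD CD (sub_cover TC)) andbT.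
    case/setUP: (subsetP CF _ TC) => [/imsetP[y _ ->]|/setD1P[] //].
    by apply/set0Pn; exists y; rewrite inE.
  - apply/forall_inP => T TC; apply/forall_inP => U UC.
    have TUC : [set T; U] \subset C by apply/subsetP => X /set2P[]->.
    have covTU : cover [set T; U] = T :|: U by rewrite coverU1 /cover big_set1.
    have TUD : T :|: U \in D by rewrite -covTU (hD CD) // coverS.
    have [TU0|TU0] := eqVneq (T :|: U) set0.
      by rewrite -[T](setKU T U) // [U :|: T]setUC TU0 setI0 sub0set.
    have := CM _ TUC; rewrite covTU !in_setU !in_setD1 TU0 TUD.
    rewrite orbT => /(_ isT).
    rewrite !inE => /orP[]/eqP E; apply/orP; [right|left].
      by rewrite -E subsetUr.
    by rewrite -E subsetUl.
have chM M : M \subset C -> M != set0 -> cover M \in M.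
  move=> MC /set0Pn[T0 T0M].
  case: (arg_maxnP (fun T : {set V} => #|T|) T0M) => T TM Tmax.
  suff -> : cover M = T by [].
  apply/eqP; rewrite eqEsubset (sub_cover TM) andbT.
  apply/bigcupsP => U UM.
  move/forall_inP/(_ T (subsetP MC _ TM))/forall_inP: (ch).
  case/(_ U (subsetP MC _ UM))/orP => // TU.
  suff /eqP-> : T == U by [].
  by rewrite eqEcard TU; apply: Tmax.
split.
- exact: subset_trans CD (subsetUr _ _).
- have [->|C0] := eqVneq C set0.
    by case/set0Pn: D0 => T TD; rewrite /cover big_set0; apply: hD TD (sub0set _).
  by have /(subsetP CD)/setD1P[] := chM C (subxx _) C0.
- move=> M MC; have [->|M0] := eqVneq M set0; last by rewrite chM.
  rewrite /cover big_set0 => /setUP[/imsetP[y _ /setP/(_ y)]|]; by rewrite !inE eqxx.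
Qed.

(** * Adding the faces one at a time *)

(** The nested complex of [B] is obtained from [D] by edge subdivisions, up to
    a relabeling of vertices. The relabeling is a bijection [f] from the whole
    ambient type onto [B], so that a new vertex is matched with a new set. *)
Definition realized B : Prop :=
  exists (W : finType) (E : {set {set W}}) (f : W -> {set V}),
    [/\ edge_subdivisions D E, injective f,
        forall T, T \in B <-> exists w, f w = T &
        forall G, (G \in E) = (f @: G \in nested B)].

Lemma realized_singletons : realized singletons.
Proof.
exists V, D, set1; split; [exact: EdgeSubdivisionsNil|exact: set1_inj| |].
  by move=> T; split=> [/imsetP[y _ ->]|[y <-]]; [exists y|rewrite imset_f].
exact: nested_singletons.
Qed.

Lemma realized_add B S x :
  set0 \notin B -> x |: S \notin B -> x |: S \in D ->
  S \in B -> [set x] \in B -> x \notin S ->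
  (forall T, T \in B -> T \subset x |: S -> T \subset S \/ T = [set x]) ->
  (forall U, U \in B -> ~~ [disjoint U & x |: S] -> U :|: (x |: S) \in D ->
     U :|: (x |: S) \in (x |: S) |: B) ->
  realized B -> realized ((x |: S) |: B).
Proof.
move=> B0 FB FD SB xB xS factors building [W [E [f [DE f_inj fB EN]]]].
set F := x |: S in FB FD factors building *.
have /fB[s fs] := SB; have /fB[t ft] := xB.
have fe : f @: [set s; t] = [set S; [set x]].
  by rewrite imsetU1 imset_set1 fs ft.
have hE : simplicial_complex E.
  move=> G H; rewrite !EN => GN HG; apply: nested_complex GN _; exact: imsetS.
have eE : [set s; t] \in E by rewrite EN fe edge_nested.
have card_e : #|[set s; t]| = 2.
  rewrite cards2; suff -> : s != t by [].
  apply: contraNneq xS => st; move: fs; rewrite st ft => <-; by rewrite inE.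
pose g (w : option W) := if w is Some w then f w else F.
have fF w : f w != F by apply: contraNneq FB => <-; apply/fB; exists w.
exists (option W), (stellar E [set s; t]), g; split.
- exact: EdgeSubdivisionsRcons.
- move=> [v|] [w|] //= => [/f_inj -> //|/eqP|/esym/eqP]; by rewrite (negbTE (fF _)).
- move=> T; split=> [/setU1P[->|/fB[w <-]]|[[w|] <-]]; last 2 first.
  + by apply/setU1P; right; apply/fB; exists w.
  + exact: setU11.
  + by exists None.
  + by exists (Some w).
move=> G; rewrite mem_stellar //.
have gSome (H : {set W}) : g @: (Some @: H) = f @: H by rewrite -imset_comp.
have Ff (H : {set W}) : F \notin f @: H.
  by apply/imsetP => -[w _ /esym/eqP]; rewrite (negbTE (fF w)).
have sube (H : {set W}) : ([set s; t] \subset H) = ([set S; [set x]] \subset f @: H).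
  by rewrite -fe; apply/idP/idP => [/imsetS-> //|/subsetP sub];
     apply/subsetP => w /(imset_f f)/sub; rewrite mem_imset.
rewrite [in RHS](old_partK G) imsetU gSome sube !EN imsetU fe.
case: ifP => _.
  by rewrite imset_set1 nested_add_new.
by rewrite imset0 set0U nested_add_old.
Qed.

(** The position of the maximum of [F] in the enumeration of [V]. *)
Definition rank F : nat := \max_(y in F) enum_rank y.
(** The order in which the faces are added: by increasing rank, then by
    decreasing cardinality. Ties are broken arbitrarily. *)
Definition key F : nat := rank F * #|V|.+1 + (#|V| - #|F|).

Lemma key_rank F G : rank G < rank F -> key G < key F.
Proof.
move=> lt; apply: leq_trans (leq_addr _ _).
apply: leq_trans (leq_mul lt (leqnn #|V|.+1)).
by rewrite /key mulSn addnC ltn_add2r ltnS leq_subr.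
Qed.

Lemma key_card F G : rank G = rank F -> #|F| < #|G| -> key G < key F.
Proof.
move=> E lt; rewrite /key E ltn_add2l ltn_sub2l //.
exact: leq_trans lt (max_card _).
Qed.

Lemma rank_sub (F G : {set V}) : F \subset G -> rank F <= rank G.
Proof.
by move=> FG; apply/bigmax_leqP => y yF; apply: leq_bigmax_cond; apply: (subsetP FG).
Qed.

Lemma rank_in (F : {set V}) y : y \in F -> enum_rank y <= rank F.
Proof. by move=> yF; apply: leq_bigmax_cond. Qed.

(** The families met during the process: a face with at least two elements is
    present as soon as one with a larger key is. *)
Definition stage B : Prop :=
  [/\ singletons \subset B, B \subset full &
      forall F G, F \in B -> 1 < #|F| -> G \in D -> 1 < #|G| ->
        key G < key F -> G \in B].

Lemma stage_realized B : stage B -> realized B -> realized full.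
Proof.
have [n] := ubnP #|full :\: B|; elim: n B => // n IHn B.
rewrite ltnS => le_n [sB Bf init] RB.
have [fB0|/set0Pn[F0 F0P]] := eqVneq (full :\: B) set0.
  suff <- : B = full by [].
  by apply/eqP; rewrite eqEsubset Bf -setD_eq0 fB0 eqxx.
have B0 : set0 \notin B.
  apply/negP => /(subsetP Bf)/setUP[/imsetP[y _ /setP/(_ y)]|]; by rewrite !inE eqxx.
have sgl y : [set y] \in B by apply: (subsetP sB); apply: imset_f.
have big T : T != set0 -> (forall y, T != [set y]) -> 1 < #|T|.
  move=> T0 T1; rewrite ltn_neqAle card_gt0 T0 andbT eq_sym.
  by apply/cards1P => -[y /eqP]; rewrite (negbTE (T1 y)).
(* The next face to be added. *)
case: (arg_minnP key F0P) => F /setDP[Ff FB] Fmin'.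
have {Fmin'}Fmin G : G \in full :\: B -> key F <= key G by exact: Fmin'.
have F1 y : F != [set y] by apply: contraNneq FB => ->.
have [F0' FD] : F != set0 /\ F \in D.
  case/setUP: Ff => [/imsetP[y _ /eqP]|/setD1P //]; by rewrite (negbTE (F1 y)).
have cF := big _ F0' F1.
have before G : G \in D -> 1 < #|G| -> key G < key F -> G \in B.
  move=> GD cG ltk; apply: contraLR ltk => GB; rewrite -leqNgt.
  apply: (Fmin G); rewrite in_setD GB in_setU in_setD1 GD -card_gt0 (ltnW cG).
  by rewrite orbT.
have after G : G \in B -> 1 < #|G| -> key G <= key F.
  by move=> GB cG; rewrite leqNgt; apply: contra FB => /(init _ _ GB cG FD cF).
have [x xF xr] : exists2 x, x \in F & rank F = enum_rank x.
  have [z zF] := set0Pn _ F0'.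
  case: (arg_maxnP (fun y : V => enum_rank y : nat) zF) => x xF xmax.
  exists x => //; apply/eqP; rewrite eqn_leq rank_in // andbT.
  by apply/bigmax_leqP.
have FE : x |: F :\ x = F by rewrite setD1K.
have SB : F :\ x \in B.
  have S0 : F :\ x != set0.
    by apply: contraNneq (F1 x) => S0; rewrite -FE S0 setU0.
  have SD : F :\ x \in D by apply: hD FD (subsetDl _ _).
  case: (ltnP 1 #|F :\ x|) => [cS|]; last first.
    rewrite leq_eqVlt ltnS leqn0 cards_eq0 (negbTE S0) orbF.
    by case/cards1P => y ->.
  apply: before => //; apply: key_rank; rewrite ltn_neqAle rank_sub ?subsetDl // andbT.
  have [z zS] := set0Pn _ S0.
  case: (eq_bigmax_cond (fun y : V => enum_rank y : nat) (A := mem (F :\ x))).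
    by rewrite card_gt0.
  move=> y yS; rewrite /rank => ->; rewrite -/(rank F) xr.
  by case/setD1P: yS => yx _; rewrite val_eqE (inj_eq enum_rank_inj).
have cardlt T U : T \subset U -> T != U -> #|T| < #|U|.
  by move=> TU ne; apply: proper_card; rewrite properEneq ne.
have Bbig T : T \in B -> (exists y, T = [set y]) \/ 1 < #|T|.
  move=> TB; case: (ltnP 1 #|T|) => [|le1]; [by right|left].
  have T0 : T != set0 by apply: contraNneq B0 => <-.
  by apply/cards1P; rewrite eqn_leq le1 card_gt0.
apply: (IHn (F |: B)).
- apply: leq_trans le_n; apply: proper_card; apply/properP; split.
    by apply: setDS; apply: subsetUr.
  by exists F; [apply/setDP|rewrite in_setD setU11].
- split.
  + exact: subset_trans sB (subsetUr _ _).
  + by rewrite subUset sub1set Ff.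
  + move=> G H /setU1P[->|GB] cG HD cH lt; apply/setU1P; right.
      exact: before.
    exact: init GB cG HD cH lt.
rewrite -FE; apply: realized_add; rewrite ?FE //.
- by rewrite !inE eqxx.
- move=> T TB TF; have [xT|xT] := boolP (x \in T); last first.
    by left; rewrite subsetD1 TF.
  right; case: (Bbig _ TB) => [[y Ty]|cT].
    by move: xT; rewrite Ty inE => /eqP->.
  suff : key F < key T by rewrite ltnNge after.
  apply: key_card; last by apply: cardlt => //; apply: contraNneq FB => <-.
  by apply/eqP; rewrite eqn_leq (rank_sub TF) andbT xr rank_in.
- move=> U UB UF UFD; apply/setU1P; case: (Bbig _ UB) => [[y Uy]|cU].
    left; case/pred0Pn: UF => z /andP[/=]; rewrite Uy inE => /eqP-> yF.
    by apply/setUidPr; rewrite sub1set.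
  have [|ne] := eqVneq (U :|: F) F; [by left|right].
  apply: before => //.
    by apply: leq_trans cF _; apply: subset_leq_card; apply: subsetUr.
  apply: key_card; last by apply: cardlt; rewrite ?subsetUr // eq_sym.
  have rUF : rank U <= rank F.
    by rewrite leqNgt; apply/negP => /key_rank; rewrite ltnNge after.
  apply/eqP; rewrite eqn_leq (rank_sub (subsetUr U F)) andbT.
  apply/bigmax_leqP => y /setUP[] /rank_in // /leq_trans; exact.
Qed.

Lemma stage_singletons : stage singletons.
Proof.
split=> //; first exact: subsetUl.
by move=> F G /imsetP[y _ ->]; rewrite cards1.
Qed.

End Nested.

(** * Conclusion *)

(** Injectivity of [f] on the whole ambient type, and surjectivity onto the
    actual vertices, suffice for an isomorphism. *)
Lemma complex_iso_imset (W U : finType) (E : {set {set W}}) (K : {set {set U}})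
    (f : W -> U) :
  injective f -> (forall u, [set u] \in K -> exists w, f w = u) ->
  (forall G : {set W}, (G \in E) = (f @: G \in K)) -> complex_iso E K.
Proof.
move=> f_inj f_surj EK.
have fK (x : vertex E) : [set f (val x)] \in K.
  by rewrite -imset_set1 -EK (valP x).
pose h (x : vertex E) : vertex K := Sub (f (val x)) (fK x).
exists h => [|F]; last first.
  by rewrite EK -imset_comp.
apply: inj_card_bij => [x y [] /f_inj /val_inj //|].
have h_surj (y : vertex K) : y \in codom h.
  have [w fw] := f_surj _ (valP y).
  have wE : [set w] \in E by rewrite EK imset_set1 fw (valP y).
  by apply/codomP; exists (Sub w wE); apply: val_inj.
apply: leq_trans (leq_image_card h (mem (vertex E))).
by apply: subset_leq_card; apply/subsetP => y _; apply: h_surj.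
Qed.

Theorem proposition3p1 (V : finType) (D : {set {set V}})
    (hD : simplicial_complex D) :
  exists (W : finType) (E : {set {set W}}),
    edge_subdivisions D E /\ complex_iso E (barycentric D).
Proof.
have [W [E [f [DE f_inj fB EN]]]] :=
  stage_realized hD (stage_singletons D) (realized_singletons D).
exists W, E; split=> //; rewrite -nested_full //.
apply: (complex_iso_imset f_inj) EN => T /nestedP[].
by rewrite sub1set => /fB.
Qed.
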